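(* Let $n\ge1$, $\delta\in\mathbb{N}^n$, and let $p,g_1,\dots,g_m$ be real polynomials in $n$ variables of multi-degree at most $\delta$, with vectors of Bernstein coefficients $b_\delta(p)=(b_{I,\delta}(p))_{I\le\delta}$ and $b_\delta(g_i)=(b_{I,\delta}(g_i))_{I\le\delta}$, $i=1,\dots,m$. Let $p^*$ be the optimal value of the problem $$\text{minimize } p(x)\quad\text{subject to } x\in[0,1]^n,\ g_i(x)\le0\ \text{ for all } i=1,\dots,m.$$ Let $(\tilde A_\delta,\tilde c_\delta)$ consist of any subset of the rows of the pair $(A_\delta,c_\delta)$ defined in the context, and let $p_\delta^*$ be the optimal value of the linear program $$\begin{array}{ll}\text{minimize}& b_\delta(p)\cdot z_\delta\\ \text{subject to}& 0_\delta\le z_\delta\le u_\delta,\\ & 1_\delta\cdot z_\delta=1,\\ & \tilde A_\delta z_\delta\le\tilde c_\delta,\\ & b_\delta(g_i)\cdot z_\delta\le0\quad\text{for all } i=1,\dots,m,\end{array}$$ in the variables $z_\delta=(z_{I,\delta})_{I\le\delta}$. Then $p_\delta^*\le p^*$.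
   Context: Multi-index notation: for $I,J\in\mathbb{N}^n$, $I\le J$ means $i_l\le j_l$ for all $l$; $x^I=x_1^{i_1}\cdots x_n^{i_n}$; $\binom{I}{J}=\prod_{l}\binom{i_l}{j_l}$; $\frac{I}{J}=(i_1/j_1,\dots,i_n/j_n)$ (with the convention $0/0=0$). Inequalities between vectors are componentwise. The optimal value of an infeasible minimization problem is $+\infty$. Bernstein polynomials: for $I\le K$ in $\mathbb{N}^n$, $B_{I,K}(x)=\prod_{l=1}^n\binom{K_l}{i_l}x_l^{i_l}(1-x_l)^{K_l-i_l}$. The Bernstein coefficients of a polynomial $q=\sum_{I\le\delta}q_Ix^I$ are $b_{I,\delta}(q)=\sum_{J\le I}\frac{\binom{I}{J}}{\binom{\delta}{J}}q_J$, so that $q=\sum_{I\le\delta}b_{I,\delta}(q)B_{I,\delta}$. Vectors indexed by $\{I:I\le\delta\}$: $u_\delta$ has entries $u_{I,\delta}=B_{I,\delta}\left(\frac{I}{\delta}\right)$; $0_\delta$ and $1_\delta$ have all entries $0$, respectively $1$. The pair $(A_\delta,c_\delta)$: for $K\le\delta$, $I\le K$, write $B_{I,K}=\sum_{J\le\delta}\hat b^{(I,K)}_JB_{J,\delta}$ (unique expansion in the Bernstein basis of degree $\delta$). Then $A_\delta z_\delta\le c_\delta$ denotes the system of linear inequalities in $z_\delta$ made of $$0\le\sum_{J\le\delta}\hat b^{(I,K)}_Jz_{J,\delta}\le B_{I,K}\left(\tfrac{I}{K}\right)\qquad\text{for all }K\le\delta,\ K\ne\delta,\ I\le K.$$ 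*)

(* Defs.v *)
(* MathComp / MathComp-Analysis.  mpoly must be imported before the analysis
   files: the opposite order fails with a clash of notation levels. *)
From mathcomp Require Import all_boot all_order all_algebra.
From mathcomp Require Import mpoly.
From mathcomp Require Import boolp classical_sets reals constructive_ereal ereal.

Set Implicit Arguments.
Unset Strict Implicit.
Unset Printing Implicit Defensive.

Import Order.TTheory GRing.Theory Num.Theory.

Local Open Scope classical_set_scope.
Local Open Scope ring_scope.

(* Multi-indices are multinomials 'X_{1..n}, compared componentwise by
   (_ <= _)%MM; [midx d] is the finite set of those below [d]. *)
Definition midx (n : nat) (d : 'X_{1..n}) : Type :=
  {dffun forall l : 'I_n, 'I_(d l).+1}.

Definition mnm_of_midx (n : nat) (d : 'X_{1..n}) (I : midx d) : 'X_{1..n} :=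
  [multinom (I l : nat) | l < n].

Coercion mnm_of_midx : midx >-> multinom.

Definition multidegree_le (R : realType) (n : nat) (d : 'X_{1..n})
    (q : {mpoly R[n]}) : Prop :=
  forall J : 'X_{1..n}, J \in msupp q -> (J <= d)%MM.

Definition mbinomial (n : nat) (I J : 'X_{1..n}) : nat :=
  (\prod_(l < n) 'C(I l, J l))%N.

(* The convention 0 / 0 = 0 is that of division in a field. *)
Definition mfrac (R : realType) (n : nat) (I K : 'X_{1..n}) : 'I_n -> R :=
  fun l => (I l)%:R / (K l)%:R.

Definition bernstein (R : realType) (n : nat) (I K : 'X_{1..n}) : {mpoly R[n]} :=
  \prod_(l < n) ('C(K l, I l)%:R *: ('X_l ^+ I l * (1 - 'X_l) ^+ (K l - I l))).

Definition bernstein_coef (R : realType) (n : nat) (d : 'X_{1..n})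
    (q : {mpoly R[n]}) (I : midx d) : R :=
  \sum_(J : midx I) ((mbinomial I J)%:R / (mbinomial d J)%:R) * q@_J.

Definition dot (R : realType) (n : nat) (d : 'X_{1..n}) (a z : midx d -> R) : R :=
  \sum_(I : midx d) a I * z I.

Definition bernstein_max (R : realType) (n : nat) (d : 'X_{1..n})
    (I : midx d) : R :=
  (bernstein R I d).@[mfrac R I d].

(* A row is a pair (a, c) standing for the inequality a . z <= c.  Each pair
   I <= K contributes two rows, one for each of the inequalities
   0 <= b . z and b . z <= B_{I,K}(I/K), where b is the coordinate vector of
   B_{I,K} in the Bernstein basis of degree d. *)
Definition bernstein_rows (R : realType) (n : nat) (d : 'X_{1..n}) :
    set ((midx d -> R) * R) :=
  [set r | exists (K I : 'X_{1..n}) (b : midx d -> R),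
    [/\ (K <= d)%MM, K <> d, (I <= K)%MM,
        bernstein R I K = \sum_(J : midx d) b J *: bernstein R J d
      & r = (fun J => - b J, 0) \/ r = (b, (bernstein R I K).@[mfrac R I K])]].

Arguments bernstein_rows R {n} d _.

Definition optimal_value (R : realType) (T : Type) (feasible : set T)
    (f : T -> R) : \bar R :=
  ereal_inf [set (f x)%:E | x in feasible].

Definition pop_feasible (R : realType) (n m : nat) (g : 'I_m -> {mpoly R[n]}) :
    set ('I_n -> R) :=
  [set x | (forall l, 0 <= x l <= 1) /\ (forall i, (g i).@[x] <= 0)].

Definition lp_feasible (R : realType) (n m : nat) (d : 'X_{1..n})
    (g : 'I_m -> {mpoly R[n]}) (rows : set ((midx d -> R) * R)) :
    set (midx d -> R) :=
  [set z | [/\ forall I, 0 <= z I <= bernstein_max R I,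
               dot (fun=> 1) z = 1,
               forall r, rows r -> dot r.1 z <= r.2
             & forall i, dot (bernstein_coef (g i)) z <= 0]].

(* Main.v *)
Require Import Defs.
From mathcomp Require Import all_boot all_order all_algebra.
From mathcomp Require Import mpoly.
From mathcomp Require Import ring.
From mathcomp Require Import boolp classical_sets reals constructive_ereal ereal.

Set Implicit Arguments.
Unset Strict Implicit.
Unset Printing Implicit Defensive.

Import Order.TTheory GRing.Theory Num.Theory.

Local Open Scope classical_set_scope.
Local Open Scope ring_scope.

(** The linear program relaxes the polynomial problem.  Each feasible point x
    of the latter is sent to the vector z of the values B_{I,d}(x) of the
    Bernstein polynomials at x; once z is known to be feasible and to have
    objective value p(x), the infimum of the linear program is taken over a
    larger set of values, hence is smaller.  This also covers an infeasible
    polynomial problem, whose value is +oo.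

    The linear objective and constraints evaluate correctly because the
    Bernstein coefficients are the coordinates of a polynomial of multi-degree
    at most d in the Bernstein basis ([bernstein_expansion]); the equation
    1 . z = 1 is the partition of unity ([sum_bernstein]).  A row attached to
    (I, K) evaluates at z to B_{I,K}(x), so these rows, like the box
    constraints on z, amount to 0 <= B_{I,K}(x) <= B_{I,K}(I/K) on the unit
    cube ([bernstein_ge0], [bernstein_le_max]).

    Since B_{I,K} is a product of univariate Bernstein polynomials, everything
    reduces to one variable: the expansion to that of the monomials x^j
    ([bernstein1_monomial]), by distributing a product of sums, and the maximum
    to the weighted arithmetic-geometric mean inequality
    ([bernstein1_le_max]). *)

Definition bernstein1 (R : pzRingType) (k i : nat) (x : R) : R :=
  'C(k, i)%:R * (x ^+ i * (1 - x) ^+ (k - i)).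

(** The unweighted inequality for the family of i copies of a and j copies
    of b. *)
Lemma weighted_AGM (R : realFieldType) (i j : nat) (a b : R) :
  0 <= a -> 0 <= b ->
  a ^+ i * b ^+ j <= ((a *+ i + b *+ j) / (i + j)%:R) ^+ (i + j).
Proof.
move=> a0 b0.
pose E (s : 'I_(i + j)) := if split s is inl _ then a else b.
have E0 : {in xpredT, forall s, 0 <= E s} by rewrite /E => s _; case: split.
have := leif_AGM E0; rewrite cardT size_enum_ord => /leifP.
have El s : E (lshift j s) = a by rewrite /E -/(unsplit (inl s)) unsplitK.
have Er s : E (rshift i s) = b by rewrite /E -/(unsplit (inr s)) unsplitK.
rewrite 2!big_split_ord (eq_bigr _ (fun s _ => El s)) (eq_bigr _ (fun s _ => Er s)).
rewrite (eq_bigr _ (fun s _ => El s)) (eq_bigr _ (fun s _ => Er s)).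
rewrite !prodr_const !sumr_const !card_ord.
by case: ifP => [_ /eqP-> | _ /ltW].
Qed.

Lemma bernstein1_ge0 (R : realFieldType) (k i : nat) (x : R) :
  0 <= x <= 1 -> 0 <= bernstein1 k i x.
Proof.
case/andP=> x0 x1; rewrite /bernstein1 mulr_ge0 ?ler0n// mulr_ge0 ?exprn_ge0//.
by rewrite subr_ge0.
Qed.

(** For 0 < i < k and t = i/k, the mean inequality for i copies of x/t and
    k - i copies of (1 - x)/(1 - t) reads
    (x/t)^i ((1 - x)/(1 - t))^(k - i) <= 1, because the sum of these numbers is
    kx + k(1 - x) = k.  At i = 0 and i = k, where one of the denominators
    vanishes, the maximum is 1 and the bound is immediate. *)
Lemma bernstein1_le_max (R : realFieldType) (k i : nat) (x : R) :
  (i <= k)%N -> 0 <= x <= 1 ->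
  bernstein1 k i x <= bernstein1 k i (i%:R / k%:R).
Proof.
move=> ik /andP[x0 x1].
have y0 : 0 <= 1 - x by rewrite subr_ge0.
have y1 : 1 - x <= 1 by rewrite lerBlDr lerDl.
rewrite /bernstein1 ler_wpM2l ?ler0n//.
case: i ik => [|i] ik.
  by rewrite mul0r !expr0 !mul1r subr0 expr1n exprn_ile1.
have k0 : (k%:R : R) != 0 by rewrite pnatr_eq0 -lt0n (leq_trans _ ik).
case: (eqVneq i.+1 k) => [<-|nik].
  rewrite subnn !expr0 !mulr1 divff ?pnatr_eq0// expr1n.
  by rewrite exprn_ile1.
have {nik} ltik : (i.+1 < k)%N by rewrite ltn_neqAle nik.
set t := _ / _.
have t0 : 0 < t by rewrite divr_gt0 ?ltr0n// (leq_trans _ ik).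
have tc : 1 - t = (k - i.+1)%:R / k%:R by rewrite natrB// mulrBl divff.
have s0 : 0 < 1 - t by rewrite tc divr_gt0 ?ltr0n ?subn_gt0// (leq_trans _ ik).
have := @weighted_AGM R i.+1 (k - i.+1) (x / t) ((1 - x) / (1 - t)).
move=> /(_ (divr_ge0 x0 (ltW t0)) (divr_ge0 y0 (ltW s0))).
rewrite subnKC//.
have -> : x / t *+ i.+1 + (1 - x) / (1 - t) *+ (k - i.+1) = k%:R.
  have j0 : ((k - i.+1)%:R : R) != 0 by rewrite pnatr_eq0 -lt0n subn_gt0.
  have i0 : (i.+1%:R : R) != 0 by rewrite pnatr_eq0.
  rewrite tc /t -2!mulr_natr; field.
  by rewrite nat1r k0 j0 i0.
rewrite divff// expr1n (expr_div_n x) (expr_div_n (1 - x)) mulf_div ler_pdivrMr ?mul1r//.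
by apply: mulr_gt0; exact: exprn_gt0.
Qed.

(** Expand x^j = x^j (x + (1 - x))^(k - j) by the binomial theorem; the term
    x^(i + j) (1 - x)^(k - j - i) has coefficient C(k - j, i), and
    C(i + j, j) C(k, i + j) = C(k, j) C(k - j, i) identifies it with a multiple
    of the Bernstein polynomial of index i + j. *)
Lemma bernstein1_monomial (R : numFieldType) (k j : nat) (x : R) :
  (j <= k)%N ->
  \sum_(i < k.+1) 'C(i, j)%:R / 'C(k, j)%:R * bernstein1 k i x = x ^+ j.
Proof.
move=> jk.
have Ckj : ('C(k, j)%:R : R) != 0 by rewrite pnatr_eq0 -lt0n bin_gt0.
rewrite -(big_mkord predT (fun i => 'C(i, j)%:R / 'C(k, j)%:R * bernstein1 k i x)).
rewrite (@big_cat_nat _ _ _ j)//=; last exact: leqW.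
(* the terms with i < j vanish, since then C(i, j) = 0 *)
rewrite big_nat big1 ?add0r => [|i /andP[_ ij]]; last first.
  by rewrite bin_small// mul0r mul0r.
rewrite -{1}[j]add0n big_addn subSn// big_mkord.
rewrite -[RHS]mulr1 -[1 in RHS](expr1n _ (k - j)) -[1 in RHS](subrK x).
rewrite exprDn mulr_sumr; apply: eq_bigr => -[i /= ilt] _.
have ikj : (i <= k - j)%N by [].
have jki : (i + j <= k)%N by rewrite addnC -leq_subRL.
have key : ('C(i + j, j) * 'C(k, i + j) = 'C(k, j) * 'C(k - j, i))%N.
  (* both sides are k! / (i! j! (k - (i + j))!) *)
  apply/eqP; rewrite -(eqn_pmul2r (_ : 0 < i`! * j`! * (k - (i + j))`!)%N); last first.
    by rewrite !muln_gt0 !fact_gt0.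
  have e1 := bin_fact (leq_addl i j); rewrite addnK in e1.
  have e2 := bin_fact jki.
  have e3 := bin_fact jk.
  have e4 := bin_fact ikj; rewrite -subnDA (addnC j) in e4.
  apply/eqP; transitivity (k`!).
    by rewrite -e2 -e1; ring.
  by rewrite -e3 -e4; ring.
rewrite /bernstein1 subnDA.
have {}key : 'C(i + j, j)%:R * 'C(k, i + j)%:R = 'C(k, j)%:R * 'C(k - j, i)%:R :> R.
  by rewrite -!natrM key.
rewrite exprD -[_ *+ 'C(k - j, i)]mulr_natr.
have -> : ('C(i + j, j)%:R / 'C(k, j)%:R : R) *
   ('C(k, i + j)%:R * (x ^+ i * x ^+ j * (1 - x) ^+ (k - i - j))) =
   'C(k, j)%:R^-1 * ('C(i + j, j)%:R * 'C(k, i + j)%:R) *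
   (x ^+ i * x ^+ j * (1 - x) ^+ (k - i - j)) by ring.
rewrite key mulKf// [(k - i - j)%N]subnAC; ring.
Qed.

(** Unlike in [bigA_distr_bigA], the range of each inner sum depends on the
    factor; finite types of dependent functions are reduced to functions into
    the tagged union of their codomains. *)
Lemma big_dffun_distr (R : comPzSemiRingType) (I : finType) (T : I -> finType)
    (F : forall i, T i -> R) :
  \prod_i \sum_(t : T i) F i t = \sum_(f : {dffun forall i, T i}) \prod_i F i (f i).
Proof.
rewrite (reindex (@dffun_of_fprod _ T)); last exact/onW_bij/dffun_of_fprod_bij.
pose P i := [ffun t => F i t].
transitivity (\sum_(t : fprod T) \prod_(i in I) P i (t i)); last first.
  by apply: eq_bigr => t _; apply: eq_bigr => i _; rewrite !ffunE.
rewrite big_fprod -(bigA_distr_big_dep _ (fun i j => untag 0 (P i) j)).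
apply: eq_bigr => i _.
transitivity (\sum_(t : T i) P i t); first by apply: eq_bigr => t _; rewrite ffunE.
exact: (big_tag (fun i => P i)).
Qed.

Lemma meval_bernstein (R : realType) (n : nat) (I K : 'X_{1..n}) (x : 'I_n -> R) :
  (bernstein R I K).@[x] = \prod_l bernstein1 (K l) (I l) (x l).
Proof.
rewrite /bernstein rmorph_prod; apply: eq_bigr => l _ /=.
by rewrite mevalZ mevalM !rmorphXn /= mevalB meval1 mevalXU.
Qed.

Lemma bernstein_ge0 (R : realType) (n : nat) (I K : 'X_{1..n}) (x : 'I_n -> R) :
  (forall l, 0 <= x l <= 1) -> 0 <= (bernstein R I K).@[x].
Proof.
by move=> x01; rewrite meval_bernstein prodr_ge0// => l _; exact: bernstein1_ge0.
Qed.

Lemma bernstein_le_max (R : realType) (n : nat) (I K : 'X_{1..n}) (x : 'I_n -> R) :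
  (I <= K)%MM -> (forall l, 0 <= x l <= 1) ->
  (bernstein R I K).@[x] <= (bernstein R I K).@[mfrac R I K].
Proof.
move=> /mnm_lepP IK x01; rewrite !meval_bernstein; apply: ler_prod => l _.
by rewrite bernstein1_ge0// bernstein1_le_max.
Qed.

Lemma midx_le (n : nat) (d : 'X_{1..n}) (I : midx d) : (I <= d)%MM.
Proof. by apply/mnm_lepP => l; rewrite mnmE -ltnS. Qed.

Lemma bernstein_monomial (R : realType) (n : nat) (d J : 'X_{1..n}) (x : 'I_n -> R) :
  (J <= d)%MM ->
  \sum_(I : midx d) (mbinomial I J)%:R / (mbinomial d J)%:R * (bernstein R I d).@[x]
    = \prod_l x l ^+ J l.
Proof.
move=> /mnm_lepP Jd.
under [RHS]eq_bigr => l _ do rewrite -(bernstein1_monomial (x l) (Jd l)).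
rewrite big_dffun_distr; apply: eq_bigr => I _.
rewrite meval_bernstein /mbinomial !natr_prod -prodf_div -big_split /=.
by apply: eq_bigr => l _; rewrite mnmE.
Qed.

(** The expansion of the monomial of exponent 0. *)
Lemma sum_bernstein (R : realType) (n : nat) (d : 'X_{1..n}) (x : 'I_n -> R) :
  \sum_(I : midx d) (bernstein R I d).@[x] = 1.
Proof.
have mbin0 (I : 'X_{1..n}) : mbinomial I 0%MM = 1%N.
  by rewrite /mbinomial big1// => l _; rewrite mnm0E bin0.
have d0 : (0 <= d)%MM by apply/mnm_lepP => l; rewrite mnm0E.
transitivity (\prod_l x l ^+ (0%MM : 'X_{1..n}) l).
  rewrite -(bernstein_monomial x d0); apply: eq_bigr => I _.
  by rewrite !mbin0 divr1 mul1r.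
by rewrite big1// => l _; rewrite mnm0E expr0.
Qed.

(** Bernstein coefficients sum over all multi-indices J <= I, evaluation over
    the support of q; this puts both sums over the same index sequence, so that
    they can be exchanged. *)
Lemma sum_midx_msupp (R : realType) (n : nat) (q : {mpoly R[n]}) (I : 'X_{1..n})
    (c : 'X_{1..n} -> R) :
  \sum_(J : midx I) c J * q@_J = \sum_(J <- msupp q | (J <= I)%MM) c J * q@_J.
Proof.
have inj : injective (@mnm_of_midx n I).
  move=> J J' /mnmP eqJ; apply/ffunP => l; apply: val_inj.
  by have := eqJ l; rewrite !mnmE.
rewrite (bigID (fun J : midx I => (J : 'X_{1..n}) \in msupp q)) /=.
rewrite addrC big1 ?add0r => [|J /memN_msupp_eq0->]; last by rewrite mulr0.
rewrite -(big_map (@mnm_of_midx n I) (mem (msupp q)) (fun J => c J * q@_J)).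
rewrite -big_filter -[RHS]big_filter; apply: perm_big; apply: uniq_perm.
- by rewrite filter_uniq// map_inj_uniq// index_enum_uniq.
- by rewrite filter_uniq.
move=> J; rewrite !mem_filter andbC; congr (_ && _).
apply/mapP/idP => [[J' _ ->]|/mnm_lepP JI]; first exact: midx_le.
exists [ffun l => inord (J l)]; first exact: mem_index_enum.
by apply/mnmP => l; rewrite mnmE ffunE inordK// ltnS.
Qed.

(** By linearity this is the expansion of the monomials, whose exponents are
    at most d by the degree hypothesis. *)
Lemma bernstein_expansion (R : realType) (n : nat) (d : 'X_{1..n})
    (q : {mpoly R[n]}) (x : 'I_n -> R) :
  multidegree_le d q ->
  dot (bernstein_coef q) (fun I : midx d => (bernstein R I d).@[x]) = q.@[x].
Proof.
move=> qd; rewrite mevalE /dot.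
transitivity (\sum_(I : midx d) \sum_(J <- msupp q)
   q@_J * ((mbinomial I J)%:R / (mbinomial d J)%:R * (bernstein R I d).@[x])).
  apply: eq_bigr => I _.
  rewrite /bernstein_coef.
  rewrite (sum_midx_msupp q (mnm_of_midx I)
    (fun J => (mbinomial (mnm_of_midx I) J)%:R / (mbinomial d J)%:R)).
  (* the condition J <= I can be dropped: C(I, J) = 0 when it fails *)
  rewrite mulr_suml big_mkcond; apply: eq_bigr => J _.
  case: ifPn => [_|/mnm_lepP nJI]; first by ring.
  have [l ltIJ] : exists l, (mnm_of_midx I l < J l)%N.
    case: (pickP (fun l => mnm_of_midx I l < J l)%N) => [l lt|none]; first by exists l.
    by case: nJI => l; rewrite leqNgt none.
  by rewrite [mbinomial (mnm_of_midx I) J](bigD1 l)//= bin_small// mul0n !mul0r mulr0.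
rewrite exchange_big /=; apply: eq_big_seq => J /qd Jd.
by rewrite -mulr_sumr bernstein_monomial.
Qed.

Theorem proposition6 (R : realType) (n m : nat) (d : 'X_{1..n})
    (p : {mpoly R[n]}) (g : 'I_m -> {mpoly R[n]})
    (rows : set ((midx d -> R) * R)) :
  (1 <= n)%N ->
  multidegree_le d p ->
  (forall i, multidegree_le d (g i)) ->
  rows `<=` bernstein_rows R d ->
  (optimal_value (lp_feasible g rows) (dot (bernstein_coef p))
     <= optimal_value (pop_feasible g) (fun x => p.@[x]))%E.
Proof.
move=> _ pd gd rowsP; apply: ereal_inf_le_tmp => _ [x [x01 gx] <-].
exists (fun I : midx d => (bernstein R I d).@[x]); last first.
  by rewrite bernstein_expansion.
split.
- by move=> I; rewrite bernstein_ge0// bernstein_le_max// midx_le.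
- by rewrite /dot -[RHS](sum_bernstein d x); apply: eq_bigr => I _; rewrite mul1r.
- move=> r /rowsP[K [I [b [Kd _ IK bE rE]]]].
  have dotE : dot b (fun J : midx d => (bernstein R J d).@[x])
      = (bernstein R I K).@[x].
    by rewrite bE raddf_sum; apply: eq_bigr => J _ /=; rewrite mevalZ.
  case: rE => -> /=; last by rewrite dotE bernstein_le_max.
  rewrite /dot; under eq_bigr => J _ do rewrite mulNr.
  by rewrite sumrN -/(dot _ _) dotE oppr_le0 bernstein_ge0.
- by move=> i; rewrite bernstein_expansion.
Qed.
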